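(* Let $(M,H)$ be a Hamilton space with Hamiltonian vector field $\rho_H$. Every infinitesimal Noether symmetry of $H$ is an infinitesimal symmetry of $\rho_H$; that is, if $X\in\mathcal{X}(T^{*}M\setminus\{0\})$ satisfies $\mathcal{L}_X\omega=0$ and $\mathcal{L}_XH=0$, then $[\rho_H,X]=0$.
   Context: Hamilton space: $M$ is a smooth $n$-dimensional manifold and $H:T^{*}M\to\mathbb{R}$ is smooth on $T^{*}M\setminus\{0\}$ (zero section removed), continuous on the zero section, with $g^{ij}=\frac{\partial^2H}{\partial p_i\partial p_j}$ of rank $n$ and constant signature on $T^{*}M\setminus\{0\}$, in induced coordinates $(x^i,p_i)$. All structures are considered on $T^{*}M\setminus\{0\}$. $\theta=p_i\,dx^i$ is the Liouville 1-form and $\omega=d\theta=dp_i\wedge dx^i$ the canonical symplectic form. The Hamiltonian vector field $\rho_H=\frac{\partial H}{\partial p_i}\frac{\partial}{\partial x^i}-\frac{\partial H}{\partial x^i}\frac{\partial}{\partial p_i}$ is determined by $i_{\rho_H}\omega=-dH$. Infinitesimal Noether symmetry of $H$: a vector field $X$ with $\mathcal{L}_X\omega=0$ and $\mathcal{L}_XH=0$. Infinitesimal symmetry of $\rho_H$: a vector field $X$ with $[\rho_H,X]=0$. *)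

(* Defs.v *)
From HB Require Import structures.
From mathcomp Require Import all_boot all_order all_algebra.
From mathcomp Require Import all_classical all_reals all_analysis.

Set Implicit Arguments.
Unset Strict Implicit.
Unset Printing Implicit Defensive.

Import Order.TTheory GRing.Theory Num.Theory.
Import numFieldNormedType.Exports.

Local Open Scope classical_set_scope.
Local Open Scope ring_scope.

Section Smooth.
Context {R : realType}.

Fixpoint Ck (k : nat) {m : nat} (U : set 'rV[R]_m) (f : 'rV[R]_m -> R) : Prop :=
  if k is k'.+1 then
    (forall z, U z -> differentiable f z) /\
    (forall a, Ck k' U (fun z => 'D_(delta_mx 0 a) f z))
  else forall z, U z -> {for z, continuous f}.

Definition smooth_on {m : nat} (U : set 'rV[R]_m) (f : 'rV[R]_m -> R) : Prop :=
  forall k, Ck k U f.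

Definition smooth_map_on {m p : nat} (U : set 'rV[R]_m)
    (F : 'rV[R]_m -> 'rV[R]_p) : Prop :=
  forall b, smooth_on U (fun z => F z 0 b).

End Smooth.

Section Calculus.
Context {R : realType}.
Implicit Types (k m p : nat).

Lemma open_near_eq m (U : set 'rV[R]_m) (W : Type) (f g : 'rV[R]_m -> W) z :
  open U -> (forall y, U y -> f y = g y) -> U z -> \near z, f z = g z.
Proof.
move=> oU fg Uz; near=> y; apply: fg; near: y.
exact: open_nbhs_nbhs.
Unshelve. all: by end_near. Qed.

Lemma near_eq_differentiable m (f g : 'rV[R]_m -> R) z :
  (\near z, f z = g z) -> differentiable f z -> differentiable g z.
Proof.
move=> fg /diff_locallyP[dfc /eqaddoP dfE].
have fgz : f z = g z by exact: nbhs_singleton fg.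
have dgE : g \o shift z = cst (g z) + 'd f z +o_ 0 id.
  apply/eqaddoP => e e0; have := dfE _ e0; apply: filter_app.
  have : \forall y \near (0 : 'rV[R]_m), f (y + z) = g (y + z).
    have := fg; rewrite [X in X -> _](near_shift 0) subr0.
    by apply: filter_app; near=> y.
  apply: filter_app; near=> y.
  move=> fgy; suff -> : (f \o shift z - (cst (f z) + 'd f z)) y =
    (g \o shift z - (cst (g z) + 'd f z)) y by [].
  by rewrite -[LHS]/(f (y + z) - (f z + 'd f z y)) fgy fgz.
have dgf : 'd g z = 'd f z :> (_ -> _) by exact: diff_unique.
by apply/diff_locallyP; rewrite dgf.
Unshelve. all: by end_near. Qed.

Lemma Ck_eq k m (U : set 'rV[R]_m) (f g : 'rV[R]_m -> R) :
  open U -> (forall z, U z -> f z = g z) -> Ck k U f -> Ck k U g.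
Proof.
elim: k f g => [|k IH] f g oU fg /=.
  move=> fc z Uz; rewrite /prop_for /continuous_at -(fg _ Uz).
  apply: cvg_trans (fc z Uz); apply: (@near_eq_cvg _ _ (nbhs z)).
  exact: open_near_eq oU fg Uz.
move=> [fd fk]; split=> [z Uz|a].
  exact: near_eq_differentiable (open_near_eq oU fg Uz) (fd z Uz).
apply: IH (fk a) => // z Uz; apply: near_eq_derive.
exact: open_near_eq oU fg Uz.
Qed.

Lemma Ck_sub k m (U V : set 'rV[R]_m) (f : 'rV[R]_m -> R) :
  V `<=` U -> Ck k U f -> Ck k V f.
Proof.
move=> VU; elim: k f => [|k IH] f /=; first by move=> fc z /VU; exact: fc.
by move=> [fd fk]; split=> [z /VU/fd //|a]; apply: IH (fk a).
Qed.

Lemma CkS k m (U : set 'rV[R]_m) (f : 'rV[R]_m -> R) : Ck k.+1 U f -> Ck k U f.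
Proof.
elim: k f => [|k IH] f /=.
  by move=> [fd _] z Uz; apply: differentiable_continuous; exact: fd.
by move=> [fd fk]; split=> // a; apply: IH; exact: fk.
Qed.

Lemma Ck_cst k m (U : set 'rV[R]_m) (c : R) : Ck k U (fun=> c).
Proof.
elim: k c => [|k IH] c /=; first by move=> z _; exact: cst_continuous.
split=> [z _|a]; first exact: differentiable_cst.
rewrite [X in Ck k U X](_ : _ = fun=> 0); first exact: IH.
by apply/funext => z; exact: derive_cst.
Qed.

Lemma derive_coord m (v z : 'rV[R]_m) b : 'D_v (fun y : 'rV[R]_m => y 0 b) z = v 0 b.
Proof.
have := @derive_mx R _ 1 m (@id 'rV[R]_m) z v (@derivable_id R _ z v).
by rewrite derive_id => /matrixP /(_ 0 b); rewrite mxE => <-.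
Qed.

Lemma Ck_coord k m (U : set 'rV[R]_m) b : Ck k U (fun z => z 0 b).
Proof.
case: k => [|k] /=; first by move=> z _; exact: (@coord_continuous R 1 m 0 b z).
split=> [z _|a]; first exact: (@differentiable_coord R 1 m z 0 b).
have -> : 'D_(delta_mx 0 a) (fun z : 'rV[R]_m => z 0 b : R) =
    fun=> (delta_mx 0 a : 'rV[R]_m) 0 b.
  by apply/funext => z; exact: derive_coord.
exact: Ck_cst.
Qed.

Lemma CkD k m (U : set 'rV[R]_m) (f g : 'rV[R]_m -> R) :
  open U -> Ck k U f -> Ck k U g -> Ck k U (f \+ g).
Proof.
move=> oU; elim: k f g => [|k IH] f g /=.
  by move=> fc gc z Uz; exact: (continuousD (fc z Uz) (gc z Uz)).
move=> [fd fk] [gd gk]; split=> [z Uz|a].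
  by apply: differentiableD; [exact: fd|exact: gd].
apply: (Ck_eq oU _ (IH _ _ (fk a) (gk a))) => z Uz /=.
by rewrite deriveD//; apply: diff_derivable; [exact: fd|exact: gd].
Qed.

Lemma CkM k m (U : set 'rV[R]_m) (f g : 'rV[R]_m -> R) :
  open U -> Ck k U f -> Ck k U g -> Ck k U (f \* g).
Proof.
move=> oU; elim: k f g => [|k IH] f g.
  by move=> fc gc z Uz; exact: (continuousM (fc z Uz) (gc z Uz)).
move=> fS gS; have [fk gk] := (CkS fS, CkS gS).
move: fS gS => /= [fd fS] [gd gS]; split=> [z Uz|a].
  by apply: differentiableM; [exact: fd|exact: gd].
apply: (Ck_eq oU _ (CkD oU (IH _ _ fk (gS a)) (IH _ _ gk (fS a)))) => z Uz /=.
by rewrite deriveM//; apply: diff_derivable; [exact: fd|exact: gd].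
Qed.

Lemma Ck_sum k m p (U : set 'rV[R]_m) (f : 'I_p -> 'rV[R]_m -> R) :
  open U -> (forall b, Ck k U (f b)) -> Ck k U (fun z => \sum_b f b z).
Proof.
move=> oU fk; rewrite (_ : (fun _ => _) = \sum_b f b).
  by elim/big_ind : _ => [|g h|b _]; [exact: Ck_cst|exact: CkD|exact: fk].
by apply/funext => z; rewrite fct_sumE.
Qed.

Lemma differentiable_row m p (F : 'rV[R]_m -> 'rV[R]_p) z :
  (forall b, differentiable (fun y => F y 0 b) z) -> differentiable F z.
Proof.
move=> Fd; rewrite (_ : F = \sum_b (fun y => F y 0 b *: delta_mx 0 b)).
  by apply: differentiable_sum => b; exact: differentiableZl.
by apply/funext => y; rewrite fct_sumE [LHS]row_sum_delta.
Qed.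

Lemma jacobianE m p (F : 'rV[R]_m -> 'rV[R]_p) z a b :
  differentiable F z -> jacobian F z a b = 'D_(delta_mx 0 a) (fun y : 'rV[R]_m => F y 0 b) z.
Proof.
move=> Fd; have := @derive_mx R _ 1 p F z (delta_mx 0 a) (diff_derivable Fd).
by rewrite deriveEjacobian// -rowE => /matrixP /(_ 0 b); rewrite !mxE.
Qed.

Lemma jacobian_comp m p q (F : 'rV[R]_m -> 'rV[R]_p) (G : 'rV[R]_p -> 'rV[R]_q) z :
  differentiable F z -> differentiable G (F z) ->
  jacobian (G \o F) z = jacobian F z *m jacobian G (F z).
Proof.
move=> Fd Gd; apply/row_matrixP => a.
rewrite row_mul !rowE /jacobian !mul_rV_lin1.
by rewrite (diff_comp Fd Gd).
Qed.

Lemma Ck_comp k m p (U : set 'rV[R]_m) (V : set 'rV[R]_p)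
    (F : 'rV[R]_m -> 'rV[R]_p) (g : 'rV[R]_p -> R) :
  open U -> (forall z, U z -> V (F z)) ->
  (forall b, Ck k U (fun z => F z 0 b)) -> Ck k V g -> Ck k U (g \o F).
Proof.
move=> oU UV; elim: k g => [|k IH] g Fk gk.
  move=> z Uz; apply: (@continuous_comp _ _ _ F g); last exact: gk (UV _ Uz).
  move=> A [B nB BA]; rewrite nbhs_filterE /=.
  have : \forall y \near z, forall b, B 0 b (F y 0 b).
    apply: (@filter_forall _ _ (fun b y => B 0 b (F y 0 b)) (nbhs z)) => b.
    exact: (Fk b z Uz _ (nB 0 b)).
  by apply: filterS => y By; apply: BA => i b /=; rewrite (ord1 i).
have Fd z : U z -> differentiable F z.
  by move=> Uz; apply: differentiable_row => b; case: (Fk b) => /(_ _ Uz).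
case: gk => gd gS; split=> [z Uz|a].
  by apply: differentiable_comp; [exact: Fd|exact: gd (UV _ Uz)].
have Fk' b : Ck k U (fun z => F z 0 b) by exact: CkS.
apply: (@Ck_eq k m U (fun z => \sum_b ('D_(delta_mx 0 b) g \o F) z *
    'D_(delta_mx 0 a) (fun y : 'rV[R]_m => F y 0 b) z)) => //; last first.
  by apply: Ck_sum => // b; apply: CkM => //; [exact: IH _ Fk' (gS b)|exact: (proj2 (Fk b) a)].
move=> z Uz /=; have gdz := gd _ (UV _ Uz).
rewrite (deriveE _ (differentiable_comp (Fd _ Uz) gdz)).
rewrite (diff_comp (Fd _ Uz) gdz) /= [X in 'd g _ X]row_sum_delta linear_sum.
apply: eq_bigr => b _; rewrite linearZ /= -(deriveE _ gdz) [RHS]mulrC.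
congr (_ * _); rewrite -jacobianE; last exact: Fd.
by rewrite -(mul_rV_lin1 ('d F z)) -rowE [RHS]mxE.
Qed.

Lemma near_eq_jacobian m p (F G : 'rV[R]_m -> 'rV[R]_p) z :
  differentiable F z -> differentiable G z -> (\near z, F z = G z) ->
  jacobian F z = jacobian G z.
Proof.
move=> Fd Gd FG; apply/matrixP => a b.
apply: (etrans (jacobianE a b Fd)); apply/esym.
apply: (etrans (jacobianE a b Gd)); apply/esym.
apply: near_eq_derive.
by apply: filterS FG => y ->.
Qed.

Lemma smooth_map_differentiable m p (U : set 'rV[R]_m) (F : 'rV[R]_m -> 'rV[R]_p) z :
  smooth_map_on U F -> U z -> differentiable F z.
Proof. by move=> Fs Uz; apply: differentiable_row => b; case: (Fs b 1%N) => /(_ _ Uz). Qed.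

End Calculus.

(* The coordinate expression f \o phi^-1 of f in the chart (U, phi); it is 0
   outside phi(U). *)
Definition coord_expr {T : Type} {V : choiceType} {W : nmodType}
    (U : set T) (phi : T -> V) (f : T -> W) : V -> W :=
  fun z => xget 0 (f @` (U `&` phi @^-1` [set z])).

(* An m-dimensional smooth atlas on a set T, not assumed maximal. *)
Record atlas (R : realType) (m : nat) (T : Type) := Atlas {
  chart_index : Type;
  dom : chart_index -> set T;
  chart : chart_index -> T -> 'rV[R]_m;
  atlas_cover : forall x, exists i, dom i x;
  chart_inj : forall i, set_inj (dom i) (chart i);
  chart_overlap_open : forall i j, open (chart i @` (dom i `&` dom j));
  chart_transition_smooth : forall i j,
    smooth_map_on (chart i @` (dom i `&` dom j))
                  (coord_expr (dom i) (chart i) (chart j)) }.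

Section AtlasTheory.
Context {R : realType} {m : nat} {T : Type} (A : atlas R m T).
Implicit Types (i j k : chart_index A) (x : T).

Lemma coord_exprE (V : choiceType) (W : nmodType) (U : set T) (phi : T -> V)
    (f : T -> W) x :
  set_inj U phi -> U x -> coord_expr U phi f (phi x) = f x.
Proof.
move=> phiI Ux; rewrite /coord_expr.
have [|y [Uy /= yx] <-] := @xgetPex _ 0 (f @` (U `&` phi @^-1` [set phi x])).
  by exists (f x), x.
by congr f; apply: phiI => //; exact/mem_set.
Qed.

Lemma chartE i (W : nmodType) (f : T -> W) x :
  dom i x -> coord_expr (dom i) (chart i) f (chart i x) = f x.
Proof. exact: coord_exprE (@chart_inj _ _ _ A i). Qed.

Definition transition i j : 'rV[R]_m -> 'rV[R]_m :=
  coord_expr (dom i) (chart i) (chart j).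

(* (jac i j x) a b = d y^b / d x^a at x, for x^a, y^b the coordinates of the
   charts i and j *)
Definition jac i j x : 'M[R]_m := jacobian (transition i j) (chart i x).

Lemma transitionE i j x : dom i x -> transition i j (chart i x) = chart j x.
Proof. exact: chartE. Qed.

Lemma transition_differentiable i j x : dom i x -> dom j x ->
  differentiable (transition i j) (chart i x).
Proof.
move=> ix jx.
by apply: (smooth_map_differentiable (chart_transition_smooth (a := A) i j)); exists x.
Qed.

Lemma jac_id i x : dom i x -> jac i i x = 1%:M.
Proof.
move=> ix; apply/matrixP => a b.
apply: (etrans (jacobianE a b (transition_differentiable ix ix))).
transitivity ('D_(delta_mx 0 a) (fun y : 'rV[R]_m => y 0 b) (chart i x)).
  have : \forall y \near chart i x, transition i i y = y.
    apply: (@open_near_eq _ _ (chart i @` (dom i `&` dom i)) _ _ id).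
    - exact: chart_overlap_open.
    - by move=> _ [y [iy _] <-]; rewrite transitionE.
    - by exists x.
  by move=> H; apply: near_eq_derive; apply: filterS H => y ->.
by rewrite derive_coord !mxE eqxx eq_sym.
Qed.

Lemma jac_comp i j k x : dom i x -> dom j x -> dom k x ->
  jac i k x = jac i j x *m jac j k x.
Proof.
move=> ix jx kx.
have ijd := transition_differentiable ix jx.
have jkd := transition_differentiable jx kx.
rewrite -(transitionE j ix) in jkd.
apply: (etrans (near_eq_jacobian (transition_differentiable ix kx)
                 (differentiable_comp ijd jkd) _)).
  apply: (@open_near_eq _ _ (chart i @` (dom i `&` dom j) `&`
                             chart i @` (dom i `&` dom k))).
  - by apply: openI; exact: chart_overlap_open.
  - move=> _ [[y [iy jy] <-] [y' [iy' ky'] yy']].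
    have E : y' = y by apply: chart_inj yy'; exact/mem_set.
    by rewrite E in ky'; rewrite /= !transitionE.
  - by split; exists x.
apply: (etrans (jacobian_comp ijd jkd)).
exact: (congr1 (fun z => jac i j x *m jacobian (transition j k) z)
               (transitionE j ix)).
Qed.

End AtlasTheory.

Record smooth_manifold (R : realType) (n : nat) := SmoothManifold {
  mfd_space :> topologicalType;
  mfd_atlas :> atlas R n mfd_space;
  mfd_hausdorff : hausdorff_space mfd_space;
  mfd_second_countable : @second_countable mfd_space;
  mfd_dom_open : forall i, open (dom (a := mfd_atlas) i);
  mfd_chart_continuous : forall i,
    {within dom (a := mfd_atlas) i, continuous (chart i)};
  mfd_chart_open : forall (i : chart_index mfd_atlas) (V : set mfd_space),
    open V -> V `<=` dom i -> open (chart i @` V) }.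

Section OpenSub.
Context {R : realType} {m : nat} {T : Type} (A : atlas R m T) (S : T -> Prop).
Context (S_open : forall i : chart_index A,
  open (chart i @` (dom i `&` [set x | S x]))).

Definition sub_dom (i : chart_index A) : set {x : T | S x} := [set x | dom i (proj1_sig x)].
Definition sub_chart (i : chart_index A) (x : {x : T | S x}) := chart i (proj1_sig x).

Fact sub_cover : forall x, exists i, sub_dom i x.
Proof. by move=> x; exact: atlas_cover. Qed.

Fact sub_inj : forall i, set_inj (sub_dom i) (sub_chart i).
Proof.
move=> i [x Sx] [y Sy] /set_mem /= ix /set_mem /= iy /= xy.
apply: eq_exist => /=; apply: chart_inj xy; exact/mem_set.
Qed.

Fact sub_overlapE i j : sub_chart i @` (sub_dom i `&` sub_dom j) =
  chart i @` (dom i `&` dom j) `&` chart i @` (dom i `&` [set x | S x]).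
Proof.
apply/seteqP; split.
  by move=> _ [[x Sx] [/= ix jx] <-]; split; exists x.
move=> _ [[x [ix jx] <-] [y [iy Sy] xy]].
have E : y = x by apply: chart_inj xy; exact/mem_set.
by rewrite E in Sy; exists (exist _ x Sy).
Qed.

Fact sub_overlap_open : forall i j, open (sub_chart i @` (sub_dom i `&` sub_dom j)).
Proof.
by move=> i j; rewrite sub_overlapE; apply: openI; [exact: chart_overlap_open|].
Qed.

Fact sub_transition_smooth : forall i j,
  smooth_map_on (sub_chart i @` (sub_dom i `&` sub_dom j))
                (coord_expr (sub_dom i) (sub_chart i) (sub_chart j)).
Proof.
move=> i j b k.
apply: (@Ck_eq _ k m _ (fun z => coord_expr (dom i) (chart i) (chart j) z 0 b)).
- exact: sub_overlap_open.
- move=> _ [x [ix jx] <-]; rewrite (coord_exprE _ (@sub_inj i) ix).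
  by rewrite {1}/sub_chart chartE.
- apply: (@Ck_sub _ k m (chart i @` (dom i `&` dom j))).
    by rewrite sub_overlapE => z [].
  exact: chart_transition_smooth.
Qed.

Definition open_subatlas : atlas R m {x : T | S x} :=
  @Atlas R m {x : T | S x} (chart_index A) sub_dom sub_chart
    sub_cover sub_inj sub_overlap_open sub_transition_smooth.

End OpenSub.

Section Cotangent.
Context {R : realType} {n : nat} {T : Type}.

(* A covector at base is given by its components p_a in every chart around
   base, subject to p_a = p'_b dy^b/dx^a; the value 0 in the other charts only
   makes this representation unique. *)
Record cotangent (A : atlas R n T) := Cotangent {
  base : T;
  momentum : chart_index A -> 'rV[R]_n;
  momentum_out : forall i, ~ dom i base -> momentum i = 0;
  momentum_change : forall i j, dom i base -> dom j base ->
    momentum i = momentum j *m (jac i j base)^T }.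

Context (A : atlas R n T).
Implicit Types (i j : chart_index A) (q : cotangent A).

Definition cotangent_dom i : set (cotangent A) := [set q | dom i (base q)].

(* the induced coordinates (x^a, p_a) *)
Definition cotangent_chart i q : 'rV[R]_(n + n) :=
  row_mx (chart i (base q)) (momentum q i).

Definition covector i (x : T) (p : 'rV[R]_n) (j : chart_index A) : 'rV[R]_n :=
  if pselect (dom j x) then p *m (jac j i x)^T else 0.

Lemma cotangent_of_coords i x (p : 'rV[R]_n) : dom i x ->
  exists2 q, base q = x & momentum q i = p.
Proof.
move=> ix.
have out j : ~ dom j x -> covector i x p j = 0.
  by rewrite /covector; case: pselect.
have cE j : dom j x -> covector i x p j = p *m (jac j i x)^T.
  by rewrite /covector; case: pselect.
have change j k : dom j x -> dom k x ->
    covector i x p j = covector i x p k *m (jac j k x)^T.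
  move=> jx kx; rewrite (cE _ jx) (cE _ kx) -mulmxA -trmx_mul.
  exact: (congr1 (fun J => p *m J^T) (jac_comp jx kx ix)).
exists (Cotangent out change) => //=.
by rewrite (cE _ ix) (jac_id ix) trmx1 mulmx1.
Qed.

Lemma cotangent_eq i q q' : dom i (base q) -> base q = base q' ->
  momentum q i = momentum q' i -> q = q'.
Proof.
case: q q' => x p po pc [x' p' po' pc'] /= ix xx'; subst x' => pp'.
have E : p = p'.
  apply/funext => j; have [jx|jx] := pselect (dom j x).
    by rewrite (pc j i) ?(pc' j i) ?pp'.
  by rewrite po ?po'.
subst p'; congr Cotangent; exact: Prop_irrelevance.
Qed.

Fact cotangent_cover : forall q, exists i, cotangent_dom i q.
Proof. by move=> q; exact: atlas_cover. Qed.

Fact cotangent_chart_inj : forall i, set_inj (cotangent_dom i) (cotangent_chart i).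
Proof.
move=> i q q' /set_mem /= iq /set_mem /= iq' /eq_row_mx[xx' pp'].
by apply: (cotangent_eq iq) => //; apply: chart_inj xx'; exact/mem_set.
Qed.

Lemma cotangent_overlapE i j :
  cotangent_chart i @` (cotangent_dom i `&` cotangent_dom j) =
  lsubmx @^-1` (chart i @` (dom i `&` dom j)).
Proof.
apply/seteqP; split.
  move=> _ [q [iq jq] <-] /=; exists (base q) => //.
  by rewrite /cotangent_chart row_mxKl.
move=> z [x [ix jx] xz].
have [q qx qz] := cotangent_of_coords (rsubmx z) ix.
exists q; first by rewrite /cotangent_dom /= qx.
by rewrite /cotangent_chart qx qz xz hsubmxK.
Qed.

Fact cotangent_overlap_open : forall i j,
  open (cotangent_chart i @` (cotangent_dom i `&` cotangent_dom j)).
Proof.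
move=> i j; rewrite cotangent_overlapE; apply: open_comp.
  by move=> z _; apply: differentiable_continuous; exact: differentiable_lsubmx.
exact: chart_overlap_open.
Qed.

Fact cotangent_transition_smooth : forall i j,
  smooth_map_on (cotangent_chart i @` (cotangent_dom i `&` cotangent_dom j))
    (coord_expr (cotangent_dom i) (cotangent_chart i) (cotangent_chart j)).
Proof.
move=> i j b k; set W := _ @` _; have oW : open W by exact: cotangent_overlap_open.
have Wl z : W z -> (chart i @` (dom i `&` dom j)) (lsubmx z).
  by rewrite /W cotangent_overlapE.
have Wl' z : W z -> (chart j @` (dom j `&` dom i)) (transition i j (lsubmx z)).
  by move=> /Wl[x [ix jx] <-]; exists x; rewrite ?transitionE.
have lk c : Ck k W (fun z => (lsubmx z : 'rV[R]_n) 0 c).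
  apply: (Ck_eq oW _ (Ck_coord k W (lshift n c))) => z _; by rewrite mxE.
have tk c : Ck k W (fun z => transition i j (lsubmx z) 0 c).
  apply: (@Ck_comp R k _ _ W _ lsubmx (fun y => transition i j y 0 c) oW Wl lk).
  exact: (chart_transition_smooth (a := A) i j c k).
case: (split_ordP b) => c ->.
  apply: (Ck_eq oW _ (tk c)) => _ [q [iq jq] <-].
  rewrite (coord_exprE _ (@cotangent_chart_inj i) iq) /cotangent_chart row_mxEl row_mxKl.
  by rewrite transitionE.
apply: (@Ck_eq _ k _ _ (fun z => \sum_d z 0 (rshift n d) *
    'D_(delta_mx 0 c) (fun y : 'rV[R]_n => transition j i y 0 d) (transition i j (lsubmx z)))) => //.
  move=> _ [q [iq jq] <-].
  rewrite (coord_exprE _ (@cotangent_chart_inj i) iq) /cotangent_chart row_mxEr row_mxKl transitionE//.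
  rewrite (momentum_change jq iq) mxE; apply: eq_bigr => d _.
  rewrite row_mxEr mxE; congr (_ * _); apply/esym.
  by apply: jacobianE; exact: transition_differentiable.
apply: Ck_sum => // d; apply: CkM => //; first exact: Ck_coord.
apply: (@Ck_comp R k _ _ W _ (transition i j \o lsubmx)
  ('D_(delta_mx 0 c) (fun y : 'rV[R]_n => transition j i y 0 d : R)) oW Wl' tk).
exact: (proj2 (chart_transition_smooth (a := A) j i d k.+1)).
Qed.

Definition cotangent_atlas : atlas R (n + n) (cotangent A) :=
  @Atlas R (n + n) (cotangent A) (chart_index A) cotangent_dom cotangent_chart
    cotangent_cover cotangent_chart_inj cotangent_overlap_open
    cotangent_transition_smooth.

Definition nonzero_covector q : Prop := exists i, momentum q i != 0.

Lemma nonzero_covector_open : forall i : chart_index cotangent_atlas,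
  open (chart i @` (dom i `&` [set q | nonzero_covector q])).
Proof.
move=> i.
rewrite (_ : _ @` _ = cotangent_chart i @` (cotangent_dom i `&` cotangent_dom i) `&`
    rsubmx @^-1` [set p : 'rV[R]_n | p != 0]).
  apply: openI; first exact: cotangent_overlap_open.
  apply: open_comp.
    by move=> z _; apply: differentiable_continuous; exact: differentiable_rsubmx.
  rewrite (_ : [set p | _] = ~` [set 0]); last by apply/seteqP; split => p /=; move/eqP.
  rewrite openC.
  exact/accessible_closed_set1/hausdorff_accessible/norm_hausdorff.
apply/seteqP; split.
  move=> _ [q [iq [j qj]] <-]; split; first by exists q.
  rewrite /= row_mxKr; apply: contra qj => /eqP qi.
  have [jq|jq] := pselect (dom j (base q)).
    by rewrite (momentum_change jq iq) qi mul0mx.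
  by rewrite momentum_out.
move=> _ [[q [iq _] <-]] /=; rewrite row_mxKr => qi.
by exists q => //; split => //; exists i.
Qed.

(* T^*M with its zero section removed; its atlas determines its topology. *)
Definition slit_cotangent := {q : cotangent A | nonzero_covector q}.

Definition slit_atlas : atlas R (n + n) slit_cotangent :=
  open_subatlas nonzero_covector_open.

End Cotangent.

Section TensorCalculus.
Context {R : realType} {m : nat} {T : Type} {A : atlas R m T}.
Implicit Types (i j : chart_index A) (x : T) (f : T -> R).

Definition smooth_function f : Prop :=
  forall i, smooth_on (chart i @` dom i) (coord_expr (dom i) (chart i) f).

(* (df/dz^a)(x), for z^a the coordinates of the chart i *)
Definition pd i (a : 'I_m) f x : R :=
  'D_(delta_mx 0 a) (coord_expr (dom i) (chart i) f) (chart i x).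

(* Components of tensor fields: t i x are the components at x, in the
   coordinate frame of the chart i; only the values with dom i x matter. *)
Definition components (V : Type) : Type := chart_index A -> T -> V.

Definition vanishes {V : nmodType} (t : components V) : Prop :=
  forall i x, dom i x -> t i x = 0.

Record vector_field := VectorField {
  vf_components :> components 'rV[R]_m;
  vf_change : forall i j x, dom i x -> dom j x ->
    vf_components j x = vf_components i x *m jac i j x;
  vf_smooth : forall i, smooth_map_on (chart i @` dom i)
    (coord_expr (dom i) (chart i) (vf_components i)) }.

Definition differential f : components 'rV[R]_m :=
  fun i x => \row_a pd i a f x.

Definition ext_derivative (alpha : components 'rV[R]_m) : components 'M[R]_m :=
  fun i x => \matrix_(a, b)
    (pd i a (fun y => alpha i y 0 b) x - pd i b (fun y => alpha i y 0 a) x).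

Definition interior_product (X : components 'rV[R]_m)
    (w : components 'M[R]_m) : components 'rV[R]_m :=
  fun i x => X i x *m w i x.

Definition lie_function (X : components 'rV[R]_m) f : components R :=
  fun i x => \sum_a X i x 0 a * pd i a f x.

(* (L_X w)_ab = X^c d_c w_ab + w_cb d_a X^c + w_ac d_b X^c *)
Definition lie_2form (X : components 'rV[R]_m)
    (w : components 'M[R]_m) : components 'M[R]_m :=
  fun i x => \matrix_(a, b) \sum_c
    (X i x 0 c * pd i c (fun y => w i y a b) x
     + w i x c b * pd i a (fun y => X i y 0 c) x
     + w i x a c * pd i b (fun y => X i y 0 c) x).

Definition lie_bracket (X Y : components 'rV[R]_m) : components 'rV[R]_m :=
  fun i x => \row_a \sum_b
    (X i x 0 b * pd i b (fun y => Y i y 0 a) x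
     - Y i x 0 b * pd i b (fun y => X i y 0 a) x).

End TensorCalculus.
Arguments components {R m T} A V.
Arguments vector_field {R m T} A.

(* A is congruent to a diagonal matrix with r positive, s negative and
   n - r - s zero diagonal entries. *)
Definition has_signature {R : realType} {n : nat} (A : 'M[R]_n) (r s : nat) : Prop :=
  exists P : 'M[R]_n, exists d : 'rV[R]_n,
    [/\ P \in unitmx, P *m A *m P^T = diag_mx d,
        #|[pred k | 0 < d 0 k]| = r & #|[pred k | d 0 k < 0]| = s].

Section HamiltonSpaces.
Context {R : realType} {n : nat} {M : smooth_manifold R n}.

Local Notation TM := (cotangent_atlas M).
Local Notation TM0 := (slit_atlas M).

Definition restrict_slit (H : cotangent M -> R) (q : slit_cotangent M) : R :=
  H (proj1_sig q).

(* g^{ab} = d^2 H / dp_a dp_b *)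
Definition vertical_hessian (H : cotangent M -> R) : components TM0 'M[R]_n :=
  fun i q => \matrix_(a, b)
    pd i (rshift n a) (fun q' => pd i (rshift n b) (restrict_slit H) q') q.

Record hamilton_space (H : cotangent M -> R) : Prop := HamiltonSpace {
  ham_smooth : smooth_function (A := TM0) (restrict_slit H);
  (* continuity at the points of the zero section *)
  ham_continuous : forall (i : chart_index TM) (q : cotangent M),
    dom i q -> ~ nonzero_covector q ->
    {for chart i q, continuous (coord_expr (dom i) (chart i) H)};
  ham_rank : forall (i : chart_index TM0) (q : slit_cotangent M),
    dom i q -> \rank (vertical_hessian H i q) = n;
  ham_signature : exists r s,
    forall (i : chart_index TM0) (q : slit_cotangent M),
      dom i q -> has_signature (vertical_hessian H i q) r s }.

(* theta = p_a dx^a *)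
Definition liouville_form : components TM0 'rV[R]_(n + n) :=
  fun i q => row_mx (momentum (proj1_sig q) i) 0.

Definition symplectic_form : components TM0 'M[R]_(n + n) :=
  ext_derivative liouville_form.

(* rho_H = dH/dp_a d/dx^a - dH/dx^a d/dp_a; see hamiltonian_vector_fieldP for
   i_{rho_H} omega = - dH. *)
Definition hamiltonian_vector_field (H : cotangent M -> R) :
    components TM0 'rV[R]_(n + n) :=
  fun i q => row_mx (\row_a pd i (rshift n a) (restrict_slit H) q)
                    (- \row_a pd i (lshift n a) (restrict_slit H) q).

Lemma slit_chartE (i : chart_index TM0) (q : slit_cotangent M) :
  chart i q = row_mx (chart (a := M) i (base (proj1_sig q))) (momentum (proj1_sig q) i).
Proof. by []. Qed.

Lemma pd_momentum (i : chart_index TM0) (q : slit_cotangent M) a b : dom i q ->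
  pd i a (fun q' : slit_cotangent M => momentum (proj1_sig q') i 0 b) q =
  (a == rshift n b)%:R.
Proof.
move=> iq; rewrite /pd.
transitivity ('D_(delta_mx 0 a) (fun z : 'rV[R]_(n + n) => z 0 (rshift n b)) (chart i q)).
  have : \forall z \near chart i q, coord_expr (dom i) (chart i)
     (fun q' : slit_cotangent M => momentum (proj1_sig q') i 0 b) z = z 0 (rshift n b).
    apply: (@open_near_eq _ _ (chart i @` (dom i `&` dom i)) _
             _ (fun z => z 0 (rshift n b))).
    - exact: chart_overlap_open.
    - by move=> _ [q' [iq' _] <-]; rewrite chartE// slit_chartE row_mxEr.
    - by exists q.
  by move=> E; apply: near_eq_derive; apply: filterS E.
by rewrite derive_coord mxE eqxx /= eq_sym.
Qed.

Lemma pd_cst (i : chart_index TM0) (q : slit_cotangent M) a : dom i q ->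
  pd i a (fun q' : slit_cotangent M => 0 : R) q = 0.
Proof.
move=> iq; rewrite /pd.
transitivity ('D_(delta_mx 0 a) (fun z : 'rV[R]_(n + n) => 0 : R) (chart i q)).
  have : \forall z \near chart i q, coord_expr (dom i) (chart i)
     (fun q' : slit_cotangent M => 0 : R) z = 0.
    apply: (@open_near_eq _ _ (chart i @` (dom i `&` dom i)) _ _ (fun z => 0)).
    - exact: chart_overlap_open.
    - by move=> _ [q' [iq' _] <-]; rewrite chartE.
    - by exists q.
  by move=> E; apply: near_eq_derive; apply: filterS E.
exact: derive_cst.
Qed.

(* omega = dp_a /\ dx^a, with (alpha /\ beta)(Y, Z) = alpha Y * beta Z - beta Y * alpha Z *)
Lemma symplectic_formE (i : chart_index TM0) (q : slit_cotangent M) : dom i q ->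
  symplectic_form i q = block_mx 0 (- 1%:M) 1%:M 0.
Proof.
move=> iq.
have Ll (b : 'I_n) : (fun y => liouville_form i y 0 (lshift n b)) =
    (fun q' : slit_cotangent M => momentum (proj1_sig q') i 0 b).
  by apply/funext => y; rewrite /liouville_form row_mxEl.
have Lr (b : 'I_n) : (fun y => liouville_form i y 0 (rshift n b)) = (fun=> 0).
  by apply/funext => y; rewrite /liouville_form row_mxEr mxE.
apply/matrixP => a b; rewrite mxE.
case: (split_ordP a) => a' ->; case: (split_ordP b) => b' ->;
  rewrite ?Ll ?Lr ?(pd_cst _ iq) ?(pd_momentum _ _ iq) ?block_mxEul ?block_mxEur
    ?block_mxEdl ?block_mxEdr !mxE ?eq_lrshift ?eq_rshift ?subr0 ?sub0r ?oppr0 //.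
by rewrite eq_sym.
Qed.

Lemma hamiltonian_vector_fieldP (H : cotangent M -> R)
    (i : chart_index TM0) (q : slit_cotangent M) : dom i q ->
  interior_product (hamiltonian_vector_field H) symplectic_form i q =
  - differential (restrict_slit H) i q.
Proof.
move=> iq; rewrite /interior_product (symplectic_formE iq) mul_row_block.
rewrite !mulmx0 !mulmx1 mulmxN mulmx1 add0r addr0.
apply/rowP => a; rewrite !mxE; case: (split_ordP a) => a' ->;
  by rewrite !mxE.
Qed.

Definition infinitesimal_noether_symmetry (H : cotangent M -> R)
    (X : vector_field TM0) : Prop :=
  vanishes (lie_2form X symplectic_form) /\
  vanishes (lie_function X (restrict_slit H)).

Definition infinitesimal_symmetry (rho : components TM0 'rV[R]_(n + n))
    (X : vector_field TM0) : Prop :=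
  vanishes (lie_bracket rho X).

End HamiltonSpaces.

(* Main.v *)
Require Import Defs.
From HB Require Import structures.
From mathcomp Require Import all_boot all_order all_algebra.
From mathcomp Require Import all_classical all_reals all_analysis.

Set Implicit Arguments.
Unset Strict Implicit.
Unset Printing Implicit Defensive.

Import Order.TTheory GRing.Theory Num.Theory.
Import numFieldNormedType.Exports.

Local Open Scope classical_set_scope.
Local Open Scope ring_scope.

(** Noether symmetries commute with the Hamiltonian flow because the relation
    i_rho omega = - dH determines rho from omega and H: a field X preserving
    both omega and H preserves rho, formally
      0 = L_X (i_rho omega + dH) = i_[X, rho] omega,
    and omega is nondegenerate.

    The computation takes place in one chart of the induced coordinates, where
    omega has a constant matrix J. Write D for the matrix of partial derivatives
    of the components of X (row a holds the derivatives along z^a) and Hess for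
    that of dH. Then
    - L_X omega = 0 reads D J + J D^T = 0 ([lie_2form_const]);
    - differentiating X(H) = 0 gives X Hess + dH D^T = 0
      ([differential_lie_function]), where the symmetry of Hess turns the
      contraction that the product rule produces into the one in the bracket;
    - rho = - dH J^-1 and J is constant, so the derivatives of rho form the
      matrix - Hess J^-1 ([pd_mx_mulmxr]).
    Hence [rho, X] = rho D - X (- Hess J^-1) = (dH D^T + X Hess) J^-1 = 0
    ([lie_bracket_hamiltonian]).

    The analytic input is the symmetry of second derivatives ([derive_comm]):
    both mixed derivatives of f are limits of the same second difference,
    divided by the area of a shrinking parallelogram. *)

(** * Symmetry of second derivatives *)

Section MixedDerivatives.
Context {R : realType}.

Lemma is_derive_line (V : normedModType R) (f : V -> R) (x v : V) (s : R) :
  derivable f (x + s *: v) v ->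
  is_derive s 1 (fun h => f (x + h *: v)) ('D_v f (x + s *: v)).
Proof.
have quotE : (fun h : R => h^-1 *: (((fun h => f (x + h *: v)) \o shift s)
      (h *: (1 : R)) - f (x + s *: v))) =
    (fun h : R => h^-1 *: ((f \o shift (x + s *: v)) (h *: v) - f (x + s *: v))).
  apply/funext => h /=; congr (_ *: (f _ - _)).
  by rewrite [_ *: 1]mulr1 scalerDl addrCA.
by move=> fd; split; rewrite /derivable /derive quotE.
Qed.

Lemma MVT_line (V : normedModType R) (f : V -> R) (x v : V) (t : R) : 0 < t ->
  (forall s, s \in `[0, t] -> derivable f (x + s *: v) v) ->
  exists2 c, c \in `[0, t] & f (x + t *: v) - f x = 'D_v f (x + c *: v) * t.
Proof.
move=> t0 fd; pose g h := f (x + h *: v).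
have [|s st|c ct] := @MVT_segment R g (fun h => 'D_v f (x + h *: v)) 0 t (ltW t0).
- by move=> h /subset_itv_oo_cc h0t; exact/is_derive_line/fd.
- apply: derivable_within_continuous => h h0t.
  by have [] := is_derive_line (fd h h0t).
- by rewrite /g scale0r addr0 subr0 => E; exists c.
Qed.

(** The mean value theorem is used twice: along u for the difference
    h |-> f (x + h u + t v) - f (x + h u), then along v for 'D_u f. *)
Lemma second_difference (V : normedModType R) (f : V -> R) (x u v : V) (t : R) :
  0 < t ->
  (forall a b, a \in `[0, t] -> b \in `[0, t] ->
     derivable f (x + a *: u + b *: v) u /\
     derivable ('D_u f) (x + a *: u + b *: v) v) ->
  exists c d, [/\ c \in `[0, t], d \in `[0, t] &
    f (x + t *: u + t *: v) - f (x + t *: u) - (f (x + t *: v) - f x) =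
    'D_v ('D_u f) (x + c *: u + d *: v) * t * t].
Proof.
move=> t0 fd.
have zt : 0 \in `[0, t] by rewrite in_itv /= lexx ltW.
have tt : t \in `[0, t] by rewrite in_itv /= lexx ltW.
pose g h := f (x + h *: u + t *: v) - f (x + h *: u).
have gd h : h \in `[0, t] -> is_derive h 1 g
    ('D_u f (x + h *: u + t *: v) - 'D_u f (x + h *: u)).
  move=> ht; apply: is_deriveB.
    have := @is_derive_line _ f (x + t *: v) u h; rewrite addrAC.
    under eq_fun do rewrite addrAC.
    by apply; exact: (fd h t ht tt).1.
  apply: is_derive_line; have := (fd h 0 ht zt).1.
  by rewrite scale0r addr0.
have gc : {within `[0, t], continuous g}.
  by apply: derivable_within_continuous => h /gd[].
have god h (ht : h \in `]0, t[) := gd h (subset_itv_oo_cc ht).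
have [c ct gE] := MVT_segment (ltW t0) god gc.
have [s st|d dt DE] := @MVT_line _ ('D_u f) (x + c *: u) v t t0.
  exact: (fd c s ct st).2.
exists c, d; split=> //; rewrite -DE -[X in _ * X]subr0 -gE /g.
by rewrite scale0r addr0.
Qed.

(** The second difference is symmetric in u and v, so the two ways of expressing
    it as a mixed derivative agree, though at different intermediate points. *)
Lemma mixed_derivative_approx (V : normedModType R) (f : V -> R) (x u v : V)
    (P : set V) :
  nbhs x P ->
  (forall y, P y -> derivable f y u /\ derivable f y v) ->
  (forall y, P y -> derivable ('D_u f) y v /\ derivable ('D_v f) y u) ->
  exists y z, [/\ P y, P z & 'D_v ('D_u f) y = 'D_u ('D_v f) z].
Proof.
move=> /nbhs_ballP[e /= e0 eP] fd fdd.
(* small enough for the parallelogram spanned by t u and t v to stay in the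
   ball of radius e; the summand 1 covers u = v = 0 *)
pose t := e / 2 / (`|u| + `|v| + 1).
have w0 : 0 < `|u| + `|v| + 1 :> R by rewrite ltr_wpDl// addr_ge0.
have t0 : 0 < t by rewrite !divr_gt0.
have Pt a b : a \in `[0, t] -> b \in `[0, t] -> P (x + a *: u + b *: v).
  rewrite !in_itv /= => /andP[a0 at_] /andP[b0 bt]; apply: eP.
  rewrite -ball_normE /= -addrA opprD addNKr normrN.
  apply: (le_lt_trans (ler_normD _ _)); rewrite !normrZ !ger0_norm//.
  apply: (@le_lt_trans _ _ (t * (`|u| + `|v| + 1))).
    rewrite !mulrDr mulr1; apply: ler_wpDr; first exact: ltW.
    by apply: lerD; apply: ler_wpM2r.
  by rewrite mulfVK ?gt_eqF// ltr_pdivrMr// ltr_pMr// ltr1n.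
have [a b at_ bt|c [d [ct dt E]]] := @second_difference _ f x u v t t0.
  by split; [exact: (fd _ (Pt _ _ at_ bt)).1|exact: (fdd _ (Pt _ _ at_ bt)).1].
have [a b at_ bt|c' [d' [ct' dt' E']]] := @second_difference _ f x v u t t0.
  rewrite addrAC.
  by split; [exact: (fd _ (Pt _ _ bt at_)).2|exact: (fdd _ (Pt _ _ bt at_)).2].
exists (x + c *: u + d *: v), (x + d' *: u + c' *: v); split; try exact: Pt.
have tn0 : t != 0 by rewrite gt_eqF.
(* exchange the roles of u and v in the second difference of E' *)
rewrite [x + t *: v + t *: u]addrAC [X in _ + X = _]opprD addrACA in E'.
rewrite -[X in _ + X = _]opprD E [x + c' *: v + _]addrAC in E'.
exact: (mulIf tn0 (mulIf tn0 E')).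
Qed.

(** Schwarz's theorem: by continuity at x, the equal values found at nearby points
    are within e / 2 of the two mixed derivatives at x. *)
Lemma derive_comm (V : normedModType R) (f : V -> R) (x u v : V) :
  (\forall y \near x, derivable f y u /\ derivable f y v) ->
  (\forall y \near x, derivable ('D_u f) y v /\ derivable ('D_v f) y u) ->
  {for x, continuous ('D_v ('D_u f))} ->
  {for x, continuous ('D_u ('D_v f))} ->
  'D_v ('D_u f) x = 'D_u ('D_v f) x.
Proof.
move=> fd fdd cuv cvu; apply/eqP; rewrite -subr_eq0 -normr_le0.
apply/ler_addgt0Pl => e e0; rewrite addr0.
have e2 : 0 < e / 2 by rewrite divr_gt0.
have nuv : \forall y \near x, `|'D_v ('D_u f) x - 'D_v ('D_u f) y| < e / 2.
  by apply: pseudometric_normed_Zmodule.cvgr_dist_lt e2; exact: cuv.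
have nvu : \forall y \near x, `|'D_u ('D_v f) x - 'D_u ('D_v f) y| < e / 2.
  by apply: pseudometric_normed_Zmodule.cvgr_dist_lt e2; exact: cvu.
pose P := ([set y | derivable f y u /\ derivable f y v] `&`
  [set y | derivable ('D_u f) y v /\ derivable ('D_v f) y u]) `&`
  ([set y | `|'D_v ('D_u f) x - 'D_v ('D_u f) y| < e / 2] `&`
  [set y | `|'D_u ('D_v f) x - 'D_u ('D_v f) y| < e / 2]).
have near_good : nbhs x P.
  apply: filter_app nvu; apply: filter_app nuv; apply: filter_app fdd.
  apply: filterS fd => y Py1 Py2 Py3 Py4.
  exact (conj (conj Py1 Py2) (conj Py3 Py4)).
have [y [z [[_ [yE _]] [_ [_ zE]] yz]]] := mixed_derivative_approx near_good
  (fun y Py => Py.1.1) (fun y Py => Py.1.2).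
rewrite (splitr e) (le_trans _ (lerD (ltW yE) (ltW zE)))// yz.
rewrite [X in _ <= _ + X]distrC.
by rewrite (le_trans _ (ler_normD _ _))// addrA subrK.
Qed.

End MixedDerivatives.

(** * Partial derivatives in a chart *)

Section ChartCalculus.
Context {R : realType} {m : nat} {T : Type} {A : atlas R m T}.
Implicit Types (i : chart_index A) (f g : T -> R) (x : T).

Lemma chart_range_open i : open (chart i @` dom i).
Proof. by have := @chart_overlap_open _ _ _ A i i; rewrite setIid. Qed.

Definition smooth_in i f : Prop :=
  smooth_on (chart i @` dom i) (coord_expr (dom i) (chart i) f).

(** Together with [pd_expr], this lets one replace [coord_expr], which is 0
    outside the range of the chart, by any convenient expression: the range is
    open, so only the values there matter. *)
Lemma smooth_in_expr i f (F : 'rV[R]_m -> R) :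
  (forall y, dom i y -> f y = F (chart i y)) ->
  smooth_on (chart i @` dom i) F -> smooth_in i f.
Proof.
move=> fF Fs k; apply: Ck_eq (Fs k); first exact: chart_range_open.
by move=> _ [y iy <-]; rewrite chartE// fF.
Qed.

Lemma pd_expr i a f (F : 'rV[R]_m -> R) x :
  (forall y, dom i y -> f y = F (chart i y)) -> dom i x ->
  pd i a f x = 'D_(delta_mx 0 a) F (chart i x).
Proof.
move=> fF ix.
have fFn : \forall z \near chart i x, coord_expr (dom i) (chart i) f z = F z.
  apply: (@open_near_eq _ _ (chart i @` dom i) _ _ F).
  - exact: chart_range_open.
  - by move=> _ [y iy <-]; rewrite chartE// fF.
  - by exists x.
by apply: near_eq_derive; apply: filterS fFn.
Qed.

Lemma eq_pd i a f g x : (forall y, dom i y -> f y = g y) -> dom i x ->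
  pd i a f x = pd i a g x.
Proof.
move=> fg ix; apply: pd_expr ix => y iy; by rewrite fg// chartE.
Qed.

Lemma smooth_in_differentiable i f x : smooth_in i f -> dom i x ->
  differentiable (coord_expr (dom i) (chart i) f) (chart i x).
Proof. by move=> /(_ 1)[fd _] ix; apply: fd; exists x. Qed.

Lemma pd_const i a (c : R) x : dom i x -> pd i a (fun=> c) x = 0.
Proof.
move=> ix; rewrite (@pd_expr i a _ (fun=> c))//; exact: derive_cst.
Qed.

Lemma pdM i a f g x : smooth_in i f -> smooth_in i g -> dom i x ->
  pd i a (fun y => f y * g y) x = f x * pd i a g x + g x * pd i a f x.
Proof.
move=> fs gs ix.
rewrite (@pd_expr i a _
  (coord_expr (dom i) (chart i) f \* coord_expr (dom i) (chart i) g))//.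
  have fd := diff_derivable (smooth_in_differentiable fs ix).
  have gd := diff_derivable (smooth_in_differentiable gs ix).
  by rewrite deriveM// !chartE.
by move=> y iy; rewrite /= !chartE.
Qed.

Lemma smooth_inM i f g : smooth_in i f -> smooth_in i g ->
  smooth_in i (fun y => f y * g y).
Proof.
move=> fs gs; apply: (@smooth_in_expr i _
  (coord_expr (dom i) (chart i) f \* coord_expr (dom i) (chart i) g)).
  by move=> y iy; rewrite /= !chartE.
by move=> k; apply: CkM (fs k) (gs k); exact: chart_range_open.
Qed.

Lemma pd_sum p i a (f : 'I_p -> T -> R) x :
  (forall c, smooth_in i (f c)) -> dom i x ->
  pd i a (fun y => \sum_c f c y) x = \sum_c pd i a (f c) x.
Proof.
move=> fs ix.
rewrite (@pd_expr i a _ (\sum_c coord_expr (dom i) (chart i) (f c)))//.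
  rewrite derive_sum// => c.
  exact: diff_derivable (smooth_in_differentiable (fs c) ix).
by move=> y iy; rewrite fct_sumE; apply: eq_bigr => c _; rewrite chartE.
Qed.

Lemma smooth_in_const i (c : R) : smooth_in i (fun=> c).
Proof. by apply: (@smooth_in_expr i _ (fun=> c)) => // k; exact: Ck_cst. Qed.

Lemma smooth_in_pd i a f : smooth_in i f -> smooth_in i (pd i a f).
Proof.
move=> fs.
apply: (@smooth_in_expr i _ ('D_(delta_mx 0 a) (coord_expr (dom i) (chart i) f))).
  by [].
by move=> k; have [_] := fs k.+1; exact.
Qed.

Lemma pd_comm i a b f x : smooth_in i f -> dom i x ->
  pd i a (pd i b f) x = pd i b (pd i a f) x.
Proof.
move=> fs ix; pose F := coord_expr (dom i) (chart i) f.
have pdF c : forall y, dom i y -> pd i c f y = 'D_(delta_mx 0 c) F (chart i y).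
  by [].
rewrite (@pd_expr i a (pd i b f) ('D_(delta_mx 0 b) F) x (pdF b) ix).
rewrite (@pd_expr i b (pd i a f) ('D_(delta_mx 0 a) F) x (pdF a) ix).
have oU : nbhs (chart i x) (chart i @` dom i).
  by apply: open_nbhs_nbhs; split; [exact: chart_range_open|exists x].
have Fd := (fs 1).1; have Fdd c := ((fs 2).2 c).1.
have Fc c d : {for chart i x,
    continuous ('D_(delta_mx 0 c) ('D_(delta_mx 0 d) F))}.
  by apply: ((fs 2).2 d).2; exists x.
apply: derive_comm; [| |exact: Fc|exact: Fc].
- by apply: filterS oU => y Uy; split; apply: diff_derivable; exact: Fd.
- by apply: filterS oU => y Uy; split; apply: diff_derivable; exact: Fdd.
Qed.

(** * Tensor calculus in matrix form *)

Lemma vector_field_smooth_in (X : vector_field A) i c :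
  smooth_in i (fun y => vf_components X i y 0 c).
Proof.
apply: (@smooth_in_expr i _
  (fun z => coord_expr (dom i) (chart i) (vf_components X i) z 0 c)).
  by move=> y iy; rewrite chartE.
exact: vf_smooth.
Qed.

Definition pd_mx {p} (F : components A 'rV[R]_p) : components A 'M[R]_(m, p) :=
  fun i x => \matrix_(a, c) pd i a (fun y => F i y 0 c) x.

Lemma lie_bracketE (X Y : components A 'rV[R]_m) i x :
  lie_bracket X Y i x = X i x *m pd_mx Y i x - Y i x *m pd_mx X i x.
Proof.
apply/rowP => a; rewrite !mxE -sumrB; apply: eq_bigr => b _.
by rewrite !mxE.
Qed.

(** With w constant in the chart i, the transport term of L_X w vanishes there. *)
Lemma lie_2form_const (X : components A 'rV[R]_m) w (J : 'M[R]_m) i x :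
  (forall y, dom i y -> w i y = J) -> dom i x ->
  lie_2form X w i x = pd_mx X i x *m J + J *m (pd_mx X i x)^T.
Proof.
move=> wJ ix; apply/matrixP => a b; rewrite !mxE -big_split /=.
apply: eq_bigr => c _; rewrite !mxE wJ//.
have -> : pd i c (fun y => w i y a b) x = 0.
  by rewrite -(pd_const c (J a b) ix); apply: eq_pd => // y iy; rewrite wJ.
by rewrite mulr0 add0r mulrC.
Qed.

Lemma pd_mx_mulmxr p q (F : components A 'rV[R]_p) (G : components A 'rV[R]_q)
    (N : 'M[R]_(p, q)) i x :
  (forall c, smooth_in i (fun y => F i y 0 c)) ->
  (forall y, dom i y -> G i y = F i y *m N) -> dom i x ->
  pd_mx G i x = pd_mx F i x *m N.
Proof.
move=> Fs GF ix; apply/matrixP => a b; rewrite !mxE.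
rewrite (@eq_pd i a _ (fun y => \sum_c F i y 0 c * N c b) x)//; last first.
  by move=> y iy; rewrite GF// mxE.
rewrite pd_sum// => [|c]; last exact: smooth_inM (smooth_in_const _ _).
apply: eq_bigr => c _; rewrite pdM//; last exact: smooth_in_const.
by rewrite pd_const// mulr0 add0r mulrC mxE.
Qed.

Lemma tr_hessian f i x : smooth_in i f -> dom i x ->
  (pd_mx (differential f) i x)^T = pd_mx (differential f) i x.
Proof.
move=> fs ix; apply/matrixP => a b; rewrite !mxE.
under eq_fun do rewrite mxE.
by under [in RHS]eq_fun do rewrite mxE; exact: pd_comm.
Qed.

(** The product rule gives X Hess^T + df D^T; the symmetry of the Hessian removes
    the transposition. *)
Lemma differential_lie_function (X : vector_field A) f i x :
  smooth_in i f -> dom i x ->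
  differential (lie_function X f i) i x =
  vf_components X i x *m pd_mx (differential f) i x +
  differential f i x *m (pd_mx X i x)^T.
Proof.
move=> fs ix; rewrite -tr_hessian//; apply/rowP => a; rewrite !mxE -big_split /=.
have Xs := vector_field_smooth_in X i; have dfs c := smooth_in_pd c fs.
rewrite pd_sum// => [|c]; last exact: smooth_inM.
apply: eq_bigr => c _; rewrite pdM// !mxE.
by under [in RHS]eq_fun do rewrite mxE.
Qed.

(** Writing rho = - df J^-1, the two invariance hypotheses make both terms of the
    bracket equal to (df D^T) J^-1: the first through D = - J D^T J^-1, the second
    through X Hess = - df D^T. *)
Lemma lie_bracket_hamiltonian (w : components A 'M[R]_m) (J : 'M[R]_m)
    (rho : components A 'rV[R]_m) f (X : vector_field A) i x :
  J \in unitmx -> (forall y, dom i y -> w i y = J) -> smooth_in i f ->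
  (forall y, dom i y -> interior_product rho w i y = - differential f i y) ->
  dom i x -> lie_2form X w i x = 0 ->
  (forall y, dom i y -> lie_function X f i y = 0) ->
  lie_bracket rho X i x = 0.
Proof.
move=> Ju wJ fs rhoP ix Xw Xf.
have rhoE y : dom i y -> rho i y = differential f i y *m - invmx J.
  move=> iy; rewrite mulmxN -mulNmx -rhoP// /interior_product wJ//.
  by rewrite mulmxK.
have dfs c : smooth_in i (fun y => differential f i y 0 c).
  by rewrite /smooth_in; under eq_fun do rewrite mxE; exact: smooth_in_pd.
have Xdf : vf_components X i x *m pd_mx (differential f) i x =
    - (differential f i x *m (pd_mx X i x)^T).
  apply/eqP; rewrite -addr_eq0 -differential_lie_function//; apply/eqP/rowP => a.
  by rewrite !mxE (eq_pd a Xf ix) pd_const.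
have DX : pd_mx X i x = - (J *m (pd_mx X i x)^T *m invmx J).
  have DJ : pd_mx X i x *m J = - (J *m (pd_mx X i x)^T).
    by apply/eqP; rewrite -addr_eq0 -(lie_2form_const _ wJ)// Xw.
  by rewrite -mulNmx -DJ mulmxK.
rewrite lie_bracketE (pd_mx_mulmxr dfs rhoE ix) rhoE// [X in _ *m X - _]DX.
rewrite [X in _ - X]mulmxA Xdf !mulmxN !mulNmx !opprK -!mulmxA.
by rewrite (mulKmx Ju) subrr.
Qed.

End ChartCalculus.

(** * Noether symmetries *)

(** The matrix of dp_a /\ dx^a squares to - 1, so its inverse is its opposite. *)
Lemma canonical_unitmx (R : comUnitRingType) (n : nat) :
  block_mx 0 (- 1%:M) 1%:M 0 \in @unitmx R (n + n).
Proof.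
apply: (proj1 (@mulmx1_unit _ _ _ (block_mx 0 1%:M (- 1%:M) 0) _)).
rewrite mulmx_block !(mulmx0, mul0mx, mulmx1, mul1mx) !(addr0, add0r).
by rewrite mulNmx mulmxN opprK mulmx1 scalar_mx_block.
Qed.

Theorem proposition5 (R : realType) (n : nat) (M : smooth_manifold R n)
    (H : cotangent M -> R) (hH : hamilton_space H)
    (X : vector_field (slit_atlas M)) (hX : infinitesimal_noether_symmetry H X) :
  infinitesimal_symmetry (hamiltonian_vector_field H) X.
Proof.
move: hX => [Xw XH] i q iq.
apply: (lie_bracket_hamiltonian (canonical_unitmx _ _) _
  (ham_smooth hH i) _ iq (Xw i q iq)).
- exact: symplectic_formE.
- exact: hamiltonian_vector_fieldP.
- exact: XH.
Qed.
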